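(* Let $n$ be an odd positive integer, $N$ a group of order $n$, and $G\le\mathrm{Hol}(N)$ a subgroup transitive on $N$ such that $G$ admits the parallel no-HGS property. Then there are infinitely many primes $q$ such that $M\cong G\times C_q\le \mathrm{Hol}(N\times C_q)$ is a transitive subgroup of $\mathrm{Hol}(N\times C_q)$ also admitting the parallel no-HGS property.
   Context: For a group $N$, $\mathrm{Hol}(N)=N\rtimes\mathrm{Aut}(N)$, with elements $[\eta,\alpha]$, multiplication $[\eta,\alpha][\mu,\beta]=[\eta\alpha(\mu),\alpha\beta]$, acting on $N$ by $[\eta,\alpha]\cdot\mu=\eta\alpha(\mu)$. A subgroup of $\mathrm{Hol}(N)$ is transitive if its action on $N$ is transitive. $C_q$ is the cyclic group of order $q$. The group $G\times C_q$ is viewed in $\mathrm{Hol}(N\times C_q)$ through $G\le\mathrm{Hol}(N)$ acting on the factor $N$ and $C_q$ acting by translations on the factor $C_q$. Let $L/K$ be a separable extension of degree $n$ with Galois closure $E$. It admits a Hopf–Galois structure of type $N$ ($N$ a group of order $n$) if and only if there is a transitive subgroup $M\le\mathrm{Hol}(N)$ and an isomorphism $\phi:\mathrm{Gal}(E/K)\to M$ with $\phi(\mathrm{Gal}(E/L))=\mathrm{Stab}_M(1_N)$. A parallel extension to $L/K$ is a subextension $L'/K$ of $E/K$ of degree $n$. The extension $L/K$ admits the parallel no-HGS property if it admits a Hopf–Galois structure and has a parallel extension admitting no Hopf–Galois structure of any type. A transitive subgroup $G\le\mathrm{Hol}(N)$, $|N|=n$, admits the parallel no-HGS property if separable extensions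 $L/K$ with Galois closure $E$ for which there is an isomorphism $\mathrm{Gal}(E/K)\to G$ carrying $\mathrm{Gal}(E/L)$ to $\mathrm{Stab}_G(1_N)$ admit it. In group-theoretic terms: there is a subgroup $H\le G$ of index $n$ such that, with $C=\mathrm{Core}_G(H)=\bigcap_{g\in G}gHg^{-1}$, there is no group $N'$ of order $n$, transitive subgroup $J\le\mathrm{Hol}(N')$ and isomorphism $\phi:G/C\to J$ with $\phi(H/C)=\mathrm{Stab}_J(1_{N'})$. *)

(* Defs.v *)
From HB Require Import structures.
From mathcomp Require Import all_boot all_algebra all_fingroup.

Set Implicit Arguments.
Unset Strict Implicit.
Unset Printing Implicit Defensive.

Import GroupScope.

Section Holomorph.

Variable N : finGroupType.

(* Hol(N) consists of the pairs [eta, alpha] with eta in N, alpha in Aut(N). *)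
Record hol := Hol {
  hol_pair : N * {perm N};
  _ : hol_pair.2 \in Aut [set: N]
}.

HB.instance Definition _ := [isSub for hol_pair].
HB.instance Definition _ := [Finite of hol by <:].

Definition hol_tr (x : hol) : N := (hol_pair x).1.
Definition hol_aut (x : hol) : {perm N} := (hol_pair x).2.

Lemma hol_autP (x : hol) : hol_aut x \in Aut [set: N].
Proof. by case: x. Qed.

Lemma hol_autM (x : hol) : {morph hol_aut x : mu nu / mu * nu}.
Proof.
move=> mu nu; have := hol_autP x; rewrite inE => /andP[_ /morphicP->] //;
by rewrite inE.
Qed.

Lemma hol_aut1 (x : hol) : hol_aut x 1 = 1.
Proof. by apply: (mulgI (hol_aut x 1)); rewrite -hol_autM !mulg1. Qed.

Lemma hol_eq (x y : hol) :
  hol_tr x = hol_tr y -> hol_aut x = hol_aut y -> x = y.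
Proof.
case: x => [[a s] xP]; case: y => [[b t] yP]; rewrite /hol_tr /hol_aut /=.
by move=> eq_ab eq_st; apply: val_inj; rewrite /= eq_ab eq_st.
Qed.

Definition hol_one : hol := @Hol (1, 1) (group1 _).

(* [eta, alpha][mu, beta] = [eta alpha(mu), alpha o beta]; products in
   {perm N} compose from left to right, so alpha o beta is beta * alpha. *)
Definition hol_mul (x y : hol) : hol :=
  @Hol (hol_tr x * hol_aut x (hol_tr y), hol_aut y * hol_aut x)
       (groupM (hol_autP y) (hol_autP x)).

Definition hol_inv (x : hol) : hol :=
  @Hol ((hol_aut x)^-1 (hol_tr x)^-1, (hol_aut x)^-1) (groupVr (hol_autP x)).

Lemma hol_mulA : associative hol_mul.
Proof.
move=> x y z; apply: hol_eq; rewrite /hol_mul /hol_tr /hol_aut /=.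
  by rewrite -/(hol_aut x) hol_autM permM mulgA.
by rewrite mulgA.
Qed.

Lemma hol_mul1 : left_id hol_one hol_mul.
Proof.
move=> x; apply: hol_eq; rewrite /hol_mul /hol_tr /hol_aut /=.
  by rewrite perm1 mul1g.
by rewrite mulg1.
Qed.

Lemma hol_mulV : left_inverse hol_one hol_inv hol_mul.
Proof.
move=> x; apply: hol_eq; rewrite /hol_mul /hol_tr /hol_aut /=; last first.
  by rewrite mulgV.
apply: (@perm_inj _ (hol_aut x)).
by rewrite hol_autM !permKV mulVg hol_aut1.
Qed.

HB.instance Definition _ := Finite_isGroup.Build hol hol_mulA hol_mul1 hol_mulV.

(* This is a left action, hence not an instance of the (right) actions of
   the library. *)
Definition hol_act (x : hol) (mu : N) : N := hol_tr x * hol_aut x mu.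

Lemma hol_act1 (mu : N) : hol_act 1 mu = mu.
Proof. by rewrite /hol_act /hol_tr /hol_aut /= perm1 mul1g. Qed.

Lemma hol_actM (x y : hol) (mu : N) :
  hol_act (x * y) mu = hol_act x (hol_act y mu).
Proof.
by rewrite /hol_act /hol_tr /hol_aut /= -/(hol_aut x) hol_autM permM mulgA.
Qed.

Definition hol_transitive (G : {set hol}) : Prop :=
  forall mu nu : N, exists2 x, x \in G & hol_act x mu = nu.

Definition hol_stab (G : {set hol}) (mu : N) : {set hol} :=
  [set x in G | hol_act x mu == mu].

End Holomorph.

(* For finite groups H <= G with (G, H) = (Gal(E/K), Gal(E/L)), this is Byott's
   criterion for L/K, of degree n, to admit a Hopf-Galois structure. *)
Definition admits_HGS (gT : finGroupType) (n : nat) (G H : {group gT}) : Prop :=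
  exists (N : finGroupType) (J : {group hol N}) (phi : {morphism G >-> hol N}),
    [/\ #|N| = n, hol_transitive J, isom G J phi
      & phi @* H = hol_stab J 1].

(* H corresponds to a parallel extension L'/K, whose Galois closure has group
   G / Core_G(H) over K; the core of H in G is gcore H G. That L/K itself
   admits a Hopf-Galois structure is automatic when G is transitive. *)
Definition parallel_no_HGS (N : finGroupType) (G : {group hol N}) : Prop :=
  exists H : {group hol N},
    [/\ H \subset G, #|G : H| = #|N|
      & ~ admits_HGS #|N| (G / gcore H G)%G (H / gcore H G)%G].

Section HolProduct.

Variables N Q : finGroupType.

Definition prod_id_fun (s : {perm N}) (u : N * Q) : N * Q := (s u.1, u.2).

Lemma prod_id_fun_inj (s : {perm N}) : injective (prod_id_fun s).
Proof. by move=> [a c] [b d] [/perm_inj -> ->]. Qed.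

Definition prod_id (s : {perm N}) : {perm N * Q} := perm (@prod_id_fun_inj s).

Lemma prod_id_Aut (x : hol N) : prod_id (hol_aut x) \in Aut [set: N * Q].
Proof.
rewrite inE; apply/andP; split; first by apply/subsetP => u; rewrite inE.
apply/morphicP => -[a c] [b d] _ _; rewrite !permE /prod_id_fun /=.
by rewrite hol_autM.
Qed.

(* The element of Hol(N x Q) acting on N as x and on Q as translation by c:
   ([eta, alpha], c) is sent to [(eta, c), alpha x id]. *)
Definition hol_prod (u : hol N * Q) : hol (N * Q)%type :=
  @Hol (N * Q)%type ((hol_tr u.1, u.2), prod_id (hol_aut u.1))
       (prod_id_Aut u.1).

Lemma hol_prod_act (x : hol N) (c : Q) (mu : N) (d : Q) :
  hol_act (hol_prod (x, c)) (mu, d) = (hol_act x mu, c * d).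
Proof. by rewrite /hol_act /hol_tr /hol_aut /= permE. Qed.

Lemma hol_prodM : {in [set: hol N * Q] &, {morph hol_prod : u v / u * v}}.
Proof.
move=> [x c] [y d] _ _; apply: hol_eq; rewrite /hol_tr /hol_aut /=.
  by rewrite permE.
by apply/permP => -[a e]; rewrite permM !permE /prod_id_fun /= permM.
Qed.

Canonical hol_prod_morphism := Morphism hol_prodM.

End HolProduct.

(* Main.v *)
Require Import Defs.
From mathcomp Require Import all_boot all_algebra all_fingroup all_solvable.

Set Implicit Arguments.
Unset Strict Implicit.
Unset Printing Implicit Defensive.

Import GroupScope.

(** Let [H] be a subgroup of [G] of index [n] such that the quotient of [G] by
    the core of [H] realises no Hopf-Galois structure.  For a prime [q] larger
    than [n], the subgroup [H x 1] of [G x C_q] has index [n q], and the claim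
    is that it has the same defect: a Hopf-Galois structure for it would
    descend to one for [H].

    It is convenient to get rid of the cores.  If [G] acts transitively on a
    group [N] through [Hol(N)], with [H] the stabiliser of the identity, then
    the kernel of the action is automatically the core of [H]
    ([ker_HGS_action]).  So a Hopf-Galois structure for the pair
    [(G / core, H / core)] is the same as such an action of [G]
    ([admits_HGS_core]), and the latter notion pulls back along embeddings
    ([HGS_action_injm]).

    The heart of the matter is [HGS_action_cofactor].  Let [G x C_q] act in
    this way on a group [N] of order [n q], with [H x 1] the stabiliser of 1.
    As [q > n], Sylow counting makes the Sylow [q]-subgroup [Q] of [N] unique,
    hence characteristic, so that [Hol(N)] maps to [Hol(N / Q)]
    ([hol_quo]).  The order of [Hol(N / Q)] divides [n n!], which is prime to
    [q]; therefore [C_q] acts trivially on [N / Q], and [G] alone is transitive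
    there.  Clearly [H] fixes the trivial coset.  Conversely, [C_q] preserves
    [Q] and meets the stabiliser of 1 trivially, so by counting it moves 1
    to every element of [Q]; if [g] in [G] fixes the trivial coset, i.e. moves
    1 into [Q], then some element of [C_q] undoes this, which puts [g] in [H].
    Hence [G] acts on [N / Q], of order [n], with [H] the stabiliser of the
    trivial coset. *)

(** * The holomorph as a permutation group *)

Lemma hol_act_inj (N : finGroupType) (x y : hol N) :
  hol_act x =1 hol_act y -> x = y.
Proof.
move=> eq_xy; have eq_tr : hol_tr x = hol_tr y.
  by have := eq_xy 1; rewrite /hol_act !hol_aut1 !mulg1.
apply: hol_eq => //; apply/permP => u.
by have := eq_xy u; rewrite /hol_act eq_tr => /mulgI.
Qed.

Lemma card_hol (N : finGroupType) : #|{: hol N}| = (#|N| * #|Aut [set: N]|)%N.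
Proof.
rewrite card_sub -cardsT -cardsX; apply: eq_card => -[a s].
by rewrite !inE.
Qed.

(** The order of [Hol(N)] divides [#|N| * #|N|`!], whose prime factors are at most
    [#|N|]. *)
Lemma prime_coprime_card_hol (N : finGroupType) (q : nat) :
  prime q -> (#|N| < q)%N -> coprime q #|{: hol N}|.
Proof.
move=> q_pr ltNq; have cop m : (m <= #|N|)%N -> (0 < m)%N -> coprime q m.
  move=> le_m m_gt0; rewrite prime_coprime // gtnNdvd //.
  exact: leq_ltn_trans ltNq.
rewrite card_hol coprimeMr cop //=; last by apply/card_gt0P; exists 1.
have: #|Aut [set: N]| %| #|N|`!.
  have <- : #|[set: {perm N}]| = #|N|`!.
    rewrite -cardsT -card_perm; apply: eq_card => s; rewrite !inE.
    by apply/esym/subsetP => u; rewrite inE.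
  by apply: cardSg; apply: subsetT.
move/coprime_dvdr; apply; elim: #|N| cop => [|m IHm] cop.
  by rewrite fact0 coprimen1.
rewrite factS coprimeMr cop //= IHm // => k le_km.
by apply: cop; apply: leqW.
Qed.

(** Faithfulness of the actions on [N x Q] and on [N] reduces this to comparing
    the two coordinates of [hol_prod_act]. *)
Lemma hol_prod_injm (N Q : finGroupType) : 'injm (@hol_prod N Q).
Proof.
apply/injmP => -[x c] [y d] _ _ eq_xy.
have act_eq u : hol_act x u = hol_act y u /\ c = d.
  have := hol_prod_act x c u 1; rewrite eq_xy hol_prod_act !mulg1.
  by case=> -> ->.
have [_ ->] := act_eq 1; congr (_, _).
by apply: hol_act_inj => u; have [] := act_eq u.
Qed.

(** * Holomorphs of quotients by characteristic subgroups *)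

Lemma char_hol_aut (N : finGroupType) (Q : {group N}) (x : hol N) (a : N) :
  Q \char [set: N] -> (hol_aut x a \in Q) = (a \in Q).
Proof.
move=> /andP[_ /forall_inP/(_ _ (hol_autP x))/subsetP QxQ].
apply/idP/idP => [|Qa]; last by apply: QxQ; apply: imset_f.
have /eqP imQ : hol_aut x @: Q == Q.
  rewrite eqEcard card_imset ?leqnn ?andbT; last exact: perm_inj.
  exact/subsetP.
by rewrite -{1}imQ mem_imset //; apply: perm_inj.
Qed.

Lemma hol_autB (N : finGroupType) (x : hol N) (a b : N) :
  hol_aut x (a * b^-1) = hol_aut x a * (hol_aut x b)^-1.
Proof. by apply: (mulIg (hol_aut x b)); rewrite -hol_autM !mulgKV. Qed.

Lemma mem_norm_char (N : finGroupType) (Q : {group N}) (a : N) :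
  Q \char [set: N] -> a \in 'N(Q).
Proof. by move=> charQ; apply: (subsetP (char_norm charQ)); rewrite inE. Qed.

Lemma coset_char_eq (N : finGroupType) (Q : {group N}) (a b : N) :
  Q \char [set: N] -> (coset Q a == coset Q b) = (a * b^-1 \in Q).
Proof.
move=> charQ; rewrite -mem_rcoset.
by apply/eqP/(rcoset_kercosetP (mem_norm_char a charQ) (mem_norm_char b charQ)).
Qed.

(** The representative is an arbitrary one; [hol_quo_funE] shows that the
    choice is immaterial when [Q] is characteristic. *)
Definition hol_quo_fun (N : finGroupType) (Q : {group N}) (x : hol N)
  (u : coset_of Q) : coset_of Q := coset Q (hol_aut x (repr u)).

Lemma hol_quo_funE (N : finGroupType) (Q : {group N}) (x : hol N) (a : N) :
  Q \char [set: N] -> hol_quo_fun x (coset Q a) = coset Q (hol_aut x a).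
Proof.
move=> charQ; apply/eqP; rewrite coset_char_eq // -hol_autB char_hol_aut //.
by rewrite -coset_char_eq // coset_reprK.
Qed.

Lemma hol_quo_fun_inj (N : finGroupType) (Q : {group N}) (x : hol N) :
  Q \char [set: N] -> injective (@hol_quo_fun N Q x).
Proof.
move=> charQ u v; rewrite -(coset_reprK u) -(coset_reprK v) !hol_quo_funE //.
move/eqP; rewrite coset_char_eq // -hol_autB char_hol_aut //.
by rewrite -coset_char_eq // => /eqP.
Qed.

Lemma hol_quo_Aut (N : finGroupType) (Q : {group N})
    (charQ : Q \char [set: N]) (x : hol N) :
  perm (@hol_quo_fun_inj N Q x charQ) \in Aut [set: coset_of Q].
Proof.
rewrite inE; apply/andP; split; first by apply/subsetP => u; rewrite inE.
apply/morphicP => u v _ _; rewrite !permE -(coset_reprK u) -(coset_reprK v).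
rewrite -morphM ?mem_norm_char // !hol_quo_funE // hol_autM.
by rewrite morphM ?mem_norm_char.
Qed.

Definition hol_quo (N : finGroupType) (Q : {group N})
    (charQ : Q \char [set: N]) (x : hol N) : hol (coset_of Q) :=
  @Hol (coset_of Q) (coset Q (hol_tr x), perm (@hol_quo_fun_inj N Q x charQ))
       (hol_quo_Aut charQ x).

Lemma hol_quo_act (N : finGroupType) (Q : {group N})
    (charQ : Q \char [set: N]) (x : hol N) (a : N) :
  hol_act (hol_quo charQ x) (coset Q a) = coset Q (hol_act x a).
Proof.
rewrite /hol_act {1}/hol_tr {1}/hol_aut /= permE hol_quo_funE //.
by rewrite -morphM ?mem_norm_char.
Qed.

(** As holomorphs act faithfully, it is enough to compare actions on cosets. *)
Lemma hol_quoM (N : finGroupType) (Q : {group N})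
    (charQ : Q \char [set: N]) : {morph hol_quo charQ : x y / x * y}.
Proof.
move=> x y; apply: hol_act_inj => u; rewrite -(coset_reprK u).
by rewrite hol_actM !hol_quo_act hol_actM.
Qed.

(** * Actions through a holomorph with prescribed stabiliser *)

(** [G] is not asked to act faithfully: this is what lets quotients by cores
    disappear from the arguments. *)
Definition HGS_action (gT : finGroupType) (n : nat) (G H : {group gT}) : Prop :=
  exists (N : finGroupType) (f : {morphism G >-> hol N}),
    [/\ #|N| = n, hol_transitive (f @* G)
      & {in G, forall g, (hol_act (f g) 1 == 1) = (g \in H)}].

(** The kernel lies in [H] because it fixes 1; the core acts trivially because,
    by transitivity, it lies in the stabiliser of every point. *)
Lemma ker_HGS_action (gT : finGroupType) (G H : {group gT})
    (N : finGroupType) (f : {morphism G >-> hol N}) :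
    H \subset G -> hol_transitive (f @* G) ->
    {in G, forall g, (hol_act (f g) 1 == 1) = (g \in H)} ->
  'ker f = gcore H G.
Proof.
move=> sHG trf stabf; apply/eqP; rewrite eqEsubset; apply/andP; split.
  apply: gcore_max; last exact: ker_norm.
  apply/subsetP => g kerg; rewrite -stabf ?(dom_ker kerg) //.
  by rewrite (mker kerg) hol_act1.
apply/subsetP => c coreHc; have Hc := subsetP (gcore_sub H G) c coreHc.
have Gc := subsetP sHG c Hc; apply/kerP; first exact: Gc.
apply: hol_act_inj => u.
have [_ /morphimP[g _ Gg ->] <-] := trf 1 u.
have coreHcg : c ^ g \in gcore H G.
  by rewrite memJ_norm // (subsetP (gcore_norm H G)).
(* An arbitrary point is g 1, and c g = g (c ^ g) with c ^ g again in the core,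
   hence in the stabiliser H of 1. *)
rewrite hol_act1 -hol_actM -morphM // conjgC morphM ?groupJ // hol_actM.
congr (hol_act _ _); apply/eqP; rewrite stabf; last exact: groupJ.
by apply: (subsetP (gcore_sub H G)).
Qed.

(** The two directions are inflation along the projection to the quotient by the
    core, and the first isomorphism theorem together with [ker_HGS_action]. *)
Lemma admits_HGS_core (gT : finGroupType) (n : nat) (G H : {group gT}) :
    H \subset G ->
  admits_HGS n (G / gcore H G)%G (H / gcore H G)%G <-> HGS_action n G H.
Proof.
move=> sHG; split=> [|[N [f [cardN trf stabf]]]].
  case=> [N [J [phi [cardN trJ isoJ stabJ]]]].
  have [injphi imphi] := isomP isoJ; pose C := gcore H G.
  have nCG : G \subset 'N(C) := gcore_norm H G.
  have Gq g : g \in G -> coset C g \in G / C by apply: mem_quotient.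
  have fM : {in G &, {morph (fun g => phi (coset C g)) : g k / g * k}}.
    move=> g k Gg Gk; rewrite /= (morphM (coset_morphism C)) ?(subsetP nCG) //.
    by rewrite morphM ?Gq.
  exists N, (Morphism fM); split=> // [u v | g Gg /=].
    have [x] := trJ u v; rewrite -imphi.
    case/morphimP=> [_ _ /morphimP[g _ Gg ->] ->].
    by exists (phi (coset C g)) => //; apply: (mem_morphim (Morphism fM)).
  have -> : (hol_act (phi (coset C g)) 1 == 1) =
            (phi (coset C g) \in phi @* (H / C)).
    by rewrite stabJ inE -imphi mem_morphim ?Gq.
  apply/idP/idP => [/morphimP[u Du Hu /(injmP injphi)] | Hg]; last first.
    by rewrite mem_morphim ?Gq ?mem_quotient.
  move/(_ (Gq g Gg) Du) => eq_u; rewrite -eq_u in Hu.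
  have nCH : C <| H by rewrite /normal gcore_sub (subset_trans sHG nCG).
  by rewrite -(quotientGK nCH) mem_morphpre ?(subsetP nCG).
rewrite -(ker_HGS_action sHG trf stabf).
have [phi injphi imphi] := first_isom f.
exists N, (f @* G)%G, phi; split=> //.
  by apply/isomP; split=> //; apply: imphi.
rewrite imphi; apply/setP => x; rewrite inE.
apply/morphimP/andP => [[g Gg Hg ->] | [/morphimP[g Gg _ ->] /eqP]].
  by rewrite mem_morphim // stabf.
by move/eqP; rewrite stabf // => Hg; exists g.
Qed.

Lemma HGS_action_injm (gT rT : finGroupType) (D G H : {group gT})
    (h : {morphism D >-> rT}) (n : nat) :
    'injm h -> G \subset D -> H \subset G ->
  HGS_action n (h @* G)%G (h @* H)%G -> HGS_action n G H.
Proof.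
move=> injh sGD sHG [N [f [cardN trf stabf]]].
have fhM : {in G &, {morph (fun g => f (h g)) : g k / g * k}}.
  move=> g k Gg Gk; have sG := subsetP sGD.
  by rewrite morphM ?sG // morphM // mem_morphim ?sG.
exists N, (Morphism fhM); split=> // [u v | g Gg].
  have [_ /morphimP[_ _ /morphimP[g _ Gg ->] ->] eq_v] := trf u v.
  by exists (f (h g)) => //; apply: (mem_morphim (Morphism fhM)).
rewrite /= (stabf (h g)) /=; last by rewrite mem_morphim ?(subsetP sGD).
apply/idP/idP => [/morphimP[k Dk Hk eq_hk] | Hg]; last first.
  by rewrite mem_morphim ?(subsetP sGD).
by rewrite (injmP injh _ _ _ Dk eq_hk) ?(subsetP sGD).
Qed.

(** * Removing a factor of large prime order *)

(** The number of Sylow [q]-subgroups divides [n], so it is less than [q], and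
    it is congruent to 1 modulo [q]: there is only one. *)
Lemma char_subgroup_prime_order (N : finGroupType) (n q : nat) :
    prime q -> (n < q)%N -> #|N| = (n * q)%N ->
  exists2 Q : {group N}, Q \char [set: N] & #|Q| = q.
Proof.
move=> q_pr lt_nq cardN; have q_gt0 := prime_gt0 q_pr.
have n_gt0 : (0 < n)%N.
  have : (0 < #|N|)%N by apply/card_gt0P; exists 1.
  by rewrite cardN muln_gt0 => /andP[].
have copqn : coprime q n by rewrite prime_coprime // gtnNdvd.
have [Q sylQ] := Sylow_exists q [set: N].
have oQ : #|Q| = q.
  rewrite (card_Hall sylQ) cardsT cardN partnM // part_p'nat ?mul1n.
    by rewrite part_pnat_id // pnat_id.
  by rewrite p'natE // -prime_coprime.
have Syl1 : #|'Syl_q([set: N])| = 1%N.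
  have modS := card_Syl_mod [set: N] q_pr.
  have: #|'Syl_q([set: N])| %| n.
    have := card_Syl_dvd q [set: N]; rewrite cardsT cardN Gauss_dvdl //.
    rewrite coprime_sym prime_coprime //.
    by rewrite /dvdn modS.
  move/(dvdn_leq n_gt0) => le_n.
  by rewrite -modS modn_small // (leq_ltn_trans le_n).
exists 'O_q([set: N])%G; first exact: pcore_char.
rewrite /= (normal_Hall_pcore sylQ) // /normal subsetT.
rewrite (card_Syl sylQ) in Syl1.
have /eqP := Syl1; rewrite indexg_eq1 => /subset_trans; apply.
exact: subsetIr.
Qed.

Lemma coprime_morph1 (gT rT : finGroupType) (D : {group gT})
    (f : {morphism D >-> rT}) (x : gT) :
  x \in D -> coprime #[x] #|rT| -> f x = 1.
Proof.
move=> Dx cop; apply/eqP; rewrite -order_eq1 -dvdn1 -(eqP cop) dvdn_gcd.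
by rewrite morph_order //= -cardsT order_dvdG ?inE.
Qed.

(** The group realising the descended action is the quotient of the given one by
    its characteristic subgroup of order [#|aT|], on whose cosets the factor [aT]
    acts trivially. *)
Lemma HGS_action_cofactor (gT aT : finGroupType) (G H : {group gT}) (n : nat) :
    prime #|aT| -> (n < #|aT|)%N -> H \subset G ->
    HGS_action (n * #|aT|) (setX_group G [set: aT]) (setX_group H 1) ->
  HGS_action n G H.
Proof.
move=> q_pr lt_n sHG [N [f [cardN trf stabf]]].
have [Q charQ cardQ] := char_subgroup_prime_order q_pr lt_n cardN.
have cardNQ : #|{: coset_of Q}| = n.
  have sNQ : [set: N] \subset 'N(Q) := char_norm charQ.
  have -> : #|{: coset_of Q}| = #|[set: N] / Q|.
    rewrite -cardsT; apply: eq_card => u; rewrite inE -(coset_reprK u).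
    by rewrite mem_quotient ?inE.
  rewrite card_quotient // -divgS ?subsetT // cardsT cardN cardQ mulnK //.
  exact: prime_gt0.
have GA g a : g \in G -> (g, a) \in setX_group G [set: aT].
  by move=> Gg; rewrite in_setX Gg inE.
have fM g h a b : g \in G -> h \in G -> f (g * h, a * b) = f (g, a) * f (h, b).
  by move=> Gg Gh; rewrite -morphM ?GA.
pose F := hol_quo charQ.
have FM : {morph F : x y / x * y} := hol_quoM charQ.
have FfM : {in setX_group G [set: aT] &,
    {morph (fun u => F (f u)) : u v / u * v}}.
  by move=> u v Du Dv; rewrite /= (morphM f) //; apply: hol_quoM.
have FA a : F (f (1, a)) = 1.
  apply: (@coprime_morph1 _ _ _ (Morphism FfM) (1, a)); first exact: GA.
  apply: (@coprime_dvdl _ #|aT|); last first.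
    by apply: prime_coprime_card_hol => //; rewrite cardNQ.
  rewrite order_dvdn; apply/eqP.
  have -> k : ((1, a) : gT * aT) ^+ k = (1, a ^+ k).
    by elim: k => // k IHk; rewrite !expgS IHk; congr (_, _); rewrite mul1g.
  by rewrite -cardsT expg_cardG ?inE.
have FfE g a : g \in G -> F (f (g, a)) = F (f (g, 1)).
  by move=> Gg; rewrite -{1}[g]mulg1 -{1}[a]mul1g fM // FM FA mulg1.
have FgM : {in G &, {morph (fun g => F (f (g, 1))) : g h / g * h}}.
  by move=> g h Gg Gh; rewrite -FM -fM ?mulg1.
(* The second factor fixes every coset of Q and meets the stabiliser of 1
   trivially, so its orbit of 1 is all of Q, both having #|aT| elements. *)
have orbitQ u : u \in Q -> exists a, hol_act (f (1, a)) 1 = u.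
  pose t a := hol_act (f (1, a)) 1.
  have t_inj : injective t.
    move=> a b eq_t; apply/eqP; rewrite eq_mulVg1.
    have := stabf (1, a^-1 * b) (GA _ _ (group1 G)).
    rewrite -{1}[1]mulg1 fM // hol_actM -/(t b) -eq_t -hol_actM -fM //.
    rewrite mulVg mulg1 morph1 hol_act1 eqxx in_setX group1 /= => /esym.
    by rewrite inE.
  have imt : t @: [set: aT] = Q.
    apply/eqP; rewrite eqEcard card_imset // cardsT cardQ leqnn andbT.
    apply/subsetP => _ /imsetP[a _ ->].
    rewrite -[t a]mulg1 -invg1 -coset_char_eq // -hol_quo_act -/F FA hol_act1.
    exact: eqxx.
  by rewrite -imt => /imsetP[a _ ->]; exists a.
exists (coset_of Q), (Morphism FgM); split=> //.
  move=> u v; have [x /morphimP[[g a] Dx _ ->]] := trf (repr u) (repr v).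
  have [Gg _] := setXP Dx => /(congr1 (coset Q)).
  rewrite -(hol_quo_act charQ) !coset_reprK -/F FfE // => <-.
  by exists (F (f (g, 1))) => //; apply: (mem_morphim (Morphism FgM)).
move=> g Gg /=; apply/eqP/idP => [fix_g | Hg].
  have Qg : hol_act (f (g, 1)) 1 \in Q.
    move: fix_g; rewrite -(morph1 (coset_morphism Q)) hol_quo_act /= => /eqP.
    by rewrite coset_char_eq // invg1 mulg1.
  have [a eq_a] := orbitQ _ Qg.
  (* Correcting g by a gives an element of the stabiliser of 1. *)
  have := stabf (g, a^-1) (GA _ _ Gg).
  rewrite -{1}[g]mul1g -{1}[a^-1]mulg1 fM // hol_actM -eq_a -hol_actM -fM //.
  rewrite mulVg mulg1 morph1 hol_act1 eqxx => /esym.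
  by rewrite in_setX => /andP[].
have := stabf (g, 1) (GA _ _ Gg); rewrite in_setX Hg inE eqxx => /eqP fix_g.
by rewrite -(morph1 (coset_morphism Q)) hol_quo_act fix_g.
Qed.

(** * The product with a cyclic group of large prime order *)

Lemma card_Z_prime (q : nat) : prime q -> #|'Z_q| = q.
Proof. by move=> q_pr; rewrite card_ord Zp_cast // prime_gt1. Qed.

Theorem proposition4p5 (n : nat) (N : finGroupType) (G : {group hol N})
    (odd_n : odd n) (cardN : #|N| = n)
    (trG : hol_transitive G) (parG : parallel_no_HGS G) :
  forall m : nat, exists q : nat,
    [/\ (m < q)%N, prime q
      & let M := (@hol_prod N 'Z_q @* setX G [set: 'Z_q])%G in
        [/\ setX G [set: 'Z_q] \isog M, hol_transitive M & parallel_no_HGS M]].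
Proof.
move=> m; have [q + q_pr] := prime_above (maxn m n).
rewrite gtn_max => /andP[lt_mq lt_nq]; have cardZ := card_Z_prime q_pr.
exists q; split=> // M.
have injh := hol_prod_injm N 'Z_q.
have subT (A : {set hol N * 'Z_q}) : A \subset [set: hol N * 'Z_q] := subsetT A.
split.
- exact: sub_isog.
- move=> [u c] [v d]; have [x Gx <-] := trG u v.
  exists (hol_prod (x, d * c^-1)); last by rewrite hol_prod_act mulgKV.
  by rewrite mem_morphim ?inE // Gx.
have [H [sHG indexH noHGS]] := parG.
pose H' := setX_group H (1%G : {group 'Z_q}).
have sH' : H' \subset setX_group G [set: 'Z_q] by rewrite setXS ?subsetT.
exists (@hol_prod N 'Z_q @* H')%G; split.
- exact: morphimS.
- rewrite index_injm // -divgS // !cardsX cards1 muln1 cardsT cardZ.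
  by rewrite card_prod cardZ -indexH -divgS // divn_mulAC // cardSg.
rewrite card_prod => /(admits_HGS_core _ (morphimS _ sH')).
move/(HGS_action_injm injh (subT _) sH').
rewrite cardN; move/HGS_action_cofactor; rewrite cardZ => /(_ q_pr lt_nq sHG).
by move/(admits_HGS_core _ sHG); rewrite -cardN.
Qed.
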